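(* Let $(A,\mu)$ be an alternative algebra, with $\mu(x,y)$ written $xy$, and let $\alpha\colon A\to A$ be an algebra morphism. Then $A^-_\alpha=(A,[,,]_\alpha,\alpha)$ (with both twisting maps equal to $\alpha$) is a multiplicative Hom-Lie triple system, where $$[xyz]_\alpha=\alpha\left(2[[x,y],z]-[[z,x],y]-[[y,z],x]\right)$$ and $[x,y]=xy-yx$ is the commutator bracket of $\mu$.
   Context: We work over a fixed field $\mathbf{k}$ of characteristic $0$. An alternative algebra $(A,\mu)$ is a $\mathbf{k}$-module with a bilinear multiplication such that the associator $as(x,y,z)=(xy)z-x(yz)$ is anti-symmetric in its three arguments. An algebra morphism $\alpha\colon A\to A$ is a linear map with $\alpha(xy)=\alpha(x)\alpha(y)$. A Hom-Lie triple system $(L,[,,],(\alpha_1,\alpha_2))$ is a $\mathbf{k}$-module $L$ with a trilinear map $[,,]\colon L^{\otimes 3}\to L$ and linear maps $\alpha_1,\alpha_2\colon L\to L$ (twisting maps) such that $[uvw]=-[vuw]$, $[uvw]+[wuv]+[vwu]=0$, and $$[\alpha_1(x)\alpha_2(y)[uvw]]=[[xyu]\alpha_1(v)\alpha_2(w)]+[\alpha_1(u)[xyv]\alpha_2(w)]+[\alpha_1(u)\alpha_2(v)[xyw]]$$ for all $u,v,w,x,y\in L$. When $\alpha_1=\alpha_2=\alpha$ we write $(L,[,,],\alpha)$. It is multiplicative if $\alpha_1=\alpha_2=\alpha$ and $\alpha([xyz])=[\alpha(x)\alpha(y)\alpha(z)]$ for all $x,y,z$. *)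

(* Defs.v *)
From HB Require Import structures.
From mathcomp Require Import all_boot all_algebra.

Set Implicit Arguments.
Unset Strict Implicit.
Unset Printing Implicit Defensive.

Import GRing.Theory.
Local Open Scope ring_scope.

(* MathComp's algebra structures are all associative, so a nonassociative
   algebra is given here by a module [A] and a bilinear multiplication [mu]. *)

Section NonassociativeAlgebra.
Variables (k : fieldType) (A : lmodType k).
Implicit Types (mu : {bilinear A -> A -> A}) (alpha : {linear A -> A}).

Definition associator mu (x y z : A) : A := mu (mu x y) z - mu x (mu y z).

Definition antisymmetric3 (t : A -> A -> A -> A) : Prop :=
  [/\ forall x y z, t y x z = - t x y z,
      forall x y z, t x z y = - t x y z
    & forall x y z, t z y x = - t x y z].

Definition alternative mu : Prop := antisymmetric3 (associator mu).

Definition algebra_morphism mu alpha : Prop :=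
  forall x y, alpha (mu x y) = mu (alpha x) (alpha y).

Definition commutator mu (x y : A) : A := mu x y - mu y x.

Definition twisted_bracket mu alpha (x y z : A) : A :=
  let c := commutator mu in
  alpha (c (c x y) z *+ 2 - c (c z x) y - c (c y z) x).

End NonassociativeAlgebra.

Section HomLieTriple.
Variables (k : fieldType) (L : lmodType k).
Implicit Type t : L -> L -> L -> L.

Definition trilinear t : Prop :=
  [/\ forall v w, linear (fun u => t u v w),
      forall u w, linear (fun v => t u v w)
    & forall u v, linear (fun w => t u v w)].

Record hom_lie_triple_system t (a1 a2 : L -> L) : Prop := HomLieTripleSystem {
  hlts_trilinear : trilinear t;
  hlts_linear1 : linear a1;
  hlts_linear2 : linear a2;
  hlts_left_antisym : forall u v w, t u v w = - t v u w;
  hlts_cyclic : forall u v w, t u v w + t w u v + t v w u = 0;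
  hlts_jacobi : forall u v w x y,
    t (a1 x) (a2 y) (t u v w) =
      t (t x y u) (a1 v) (a2 w) + t (a1 u) (t x y v) (a2 w)
        + t (a1 u) (a2 v) (t x y w)
}.

Definition multiplicative_hlts t (a1 a2 : L -> L) : Prop :=
  [/\ hom_lie_triple_system t a1 a2,
      a1 = a2
    & forall x y z, a1 (t x y z) = t (a1 x) (a1 y) (a1 z)].

End HomLieTriple.

(* Main.v *)
(** For an alternative algebra write (x,y,z) for the associator and
    f(w,x,y,z) = (wx,y,z) - x(w,y,z) - (x,y,z)w.  The Teichmueller identity
    makes f alternating (Bruck-Kleinfeld), and this yields
      3 f(w,x,y,z) = [w,(x,y,z)] - [x,(y,z,w)] + [y,(z,w,x)] - [z,(w,x,y)],
      ([w,x],y,z) = 2 f(w,x,y,z) - [w,(x,y,z)] + [x,(w,y,z)].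
    Since the Jacobian of the commutator is 6 (x,y,z), the triple product is
    T(x,y,z) = 3 [[x,y],z] - 6 (x,y,z).  The two identities show that every
    [u,-] is a derivation of T, and that D(x,y) = [[x,y],-] - 3 (x,y,-) is a
    derivation of the product, hence of T.  As T(x,y,-) = [[x,y],-] + 2 D(x,y),
    it is a derivation of T as well, which is the untwisted Jacobi identity;
    pulling out powers of alpha gives the twisted one. *)

Require Import Defs.
From HB Require Import structures.
From mathcomp Require Import all_boot all_algebra.

Import GRing.Theory.
Local Open Scope ring_scope.

(** * A decision procedure for identities in abelian groups *)

Inductive zexpr :=
  | ZVar of nat
  | ZZero
  | ZAdd of zexpr & zexpr
  | ZOpp of zexpr
  | ZMuln of zexpr & nat.

Fixpoint zeval (V : zmodType) (env : nat -> V) (e : zexpr) : V :=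
  match e with
  | ZVar i => env i
  | ZZero => 0
  | ZAdd e1 e2 => zeval V env e1 + zeval V env e2
  | ZOpp e1 => - zeval V env e1
  | ZMuln e1 n => zeval V env e1 *+ n
  end.

(* The coefficient of [ZVar i] is the value of the expression at the [i]-th
   unit vector. *)
Definition zcoef (e : zexpr) (i : nat) : int :=
  zeval int (fun j => (i == j)%:R) e.

Lemma zeval_coef (V : zmodType) (s : seq V) (e : zexpr) :
  zeval V (nth 0 s) e = \sum_(i < size s) s`_i *~ zcoef e i.
Proof.
rewrite /zcoef; elim: e => [j||e1 IH1 e2 IH2|e IH|e IH n] /=.
- have [lt_js|le_sj] := ltnP j (size s).
    rewrite (bigD1 (Ordinal lt_js)) //= eqxx big1 ?addr0 // => i.
    by rewrite -val_eqE /= => /negbTE->.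
  (* An index past the end evaluates to the default [0] and differs from every [i] in the sum, so
     both sides vanish. *)
  rewrite nth_default // big1 // => i _.
  by rewrite (ltn_eqF (leq_trans (ltn_ord i) le_sj)).
- by rewrite big1.
- by rewrite IH1 IH2 -big_split; apply: eq_bigr => i _; rewrite mulrzDr.
- by rewrite IH -sumrN; apply: eq_bigr => i _; rewrite mulrNz.
- rewrite IH -sumrMnl; apply: eq_bigr => i _.
  by rewrite [LHS]pmulrn -mulrzA -[Posz n]natz mulr_natr.
Qed.

(** Reduces an identity in any abelian group to finitely many closed integer equations, which
    computation decides. *)
Lemma zeval_eq (V : zmodType) (s : seq V) (e1 e2 : zexpr) :
  all (fun i => zcoef e1 i == zcoef e2 i) (iota 0 (size s)) ->
  zeval V (nth 0 s) e1 = zeval V (nth 0 s) e2.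
Proof.
move=> /allP eq12; rewrite !zeval_coef; apply: eq_bigr => i _.
by rewrite (eqP (eq12 i _)) // mem_iota /=.
Qed.

(* Atoms are compared up to conversion, since the same operation can occur with
   different inferred structures on [A]. *)
Ltac zindex t s :=
  lazymatch s with
  | ?a :: ?s' =>
    match s with
    | _ => let _ := match s with _ => unify t a end in constr:(0%N)
    | _ => let i := zindex t s' in constr:(i.+1)
    end
  end.

Ltac zatoms t s :=
  lazymatch t with
  | ?a + ?b => let s' := zatoms a s in zatoms b s'
  | - ?a => zatoms a s
  | ?a *+ _ => zatoms a s
  | 0 => s
  | _ => match s with
         | _ => let i := zindex t s in s
         | _ => constr:(t :: s)
         end
  end.

Ltac zreify t s :=
  lazymatch t with
  | ?a + ?b => let e1 := zreify a s in let e2 := zreify b s in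
               constr:(ZAdd e1 e2)
  | - ?a => let e := zreify a s in constr:(ZOpp e)
  | ?a *+ ?n => let e := zreify a s in constr:(ZMuln e n)
  | 0 => constr:(ZZero)
  | _ => let i := zindex t s in constr:(ZVar i)
  end.

Ltac zmod :=
  lazymatch goal with
  | |- @eq ?V ?a ?b =>
    let s0 := zatoms a (@nil V) in
    let s := zatoms b s0 in
    let e1 := zreify a s in
    let e2 := zreify b s in
    refine (zeval_eq _ s e1 e2 _); vm_compute; reflexivity
  end.

(** * Commutators and derivations *)

Lemma commutator_is_bilinear (k : fieldType) (A : lmodType k)
    (mu : {bilinear A -> A -> A}) :
  bilinear_for *:%R *:%R (commutator mu).
Proof.
split=> u a x y; rewrite /commutator linearPl linearPr /= scalerBr; zmod.
Qed.

HB.instance Definition _ (k : fieldType) (A : lmodType k)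
    (mu : {bilinear A -> A -> A}) :=
  bilinear_isBilinear.Build k A A A *:%R *:%R (commutator mu)
    (commutator_is_bilinear k A mu).

Definition derivation (V : zmodType) (m : V -> V -> V) (d : V -> V) : Prop :=
  forall x y, d (m x y) = m (d x) y + m x (d y).

Definition triple_derivation (V : zmodType) (t : V -> V -> V -> V)
    (d : V -> V) : Prop :=
  forall x y z, d (t x y z) = t (d x) y z + t x (d y) z + t x y (d z).

Definition bilE :=
  (@linearDl, @linearDr, @linearBl, @linearBr, @linearNl, @linearNr,
   @linearMnl, @linearMnr).

(** Loos' product, which turns a Malcev algebra into a Lie triple system; at the commutator it is
    [twisted_bracket] before [alpha] is applied. *)
Definition loos_triple (k : fieldType) (A : lmodType k)
    (b : {bilinear A -> A -> A}) (x y z : A) : A :=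
  b (b x y) z *+ 2 - b (b z x) y - b (b y z) x.

(** * The Loos triple product of a bilinear operation *)

Section LoosTriple.
Variables (k : fieldType) (A : lmodType k) (b : {bilinear A -> A -> A}).

Local Notation T := (loos_triple k A b).

Lemma loos_triple_trilinear : trilinear T.
Proof.
split=> x y a u v; rewrite /loos_triple !(linearPl, linearPr) /=
  !(scalerDr, scalerN, scalerMnr); zmod.
Qed.

Lemma loos_triple_antisym :
  (forall x y, b x y = - b y x) -> forall x y z, T x y z = - T y x z.
Proof.
move=> b_anti x y z; rewrite /loos_triple (b_anti y x) (b_anti z y) (b_anti x z).
rewrite !bilE; zmod.
Qed.

(** Each double bracket occurs with total coefficient [2 - 1 - 1]. *)
Lemma loos_triple_cyclic x y z : T x y z + T z x y + T y z x = 0.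
Proof. rewrite /loos_triple; zmod. Qed.

Lemma triple_derivationD (d1 d2 : A -> A) :
  triple_derivation A T d1 -> triple_derivation A T d2 ->
  triple_derivation A T (fun x => d1 x + d2 x).
Proof.
move=> d1P d2P x y z /=; rewrite d1P d2P /loos_triple !bilE; zmod.
Qed.

Lemma derivation_loos_triple (d : {additive A -> A}) :
  derivation A b d -> triple_derivation A T d.
Proof.
move=> dP x y z; rewrite /loos_triple !raddfB /= raddfMn /= !dP !bilE; zmod.
Qed.

Lemma loos_triple_morph (h : {linear A -> A}) :
  algebra_morphism b h -> forall x y z, h (T x y z) = T (h x) (h y) (h z).
Proof.
by move=> hM x y z; rewrite /loos_triple !linearB /= linearMn /= !hM.
Qed.

End LoosTriple.

(** * Commutators and associators in alternative algebras *)

Section Alternative.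
Variables (k : fieldType) (A : lmodType k) (mu : {bilinear A -> A -> A}).

Local Notation as_ := (associator mu).
Local Notation c := (commutator mu).
Local Notation T := (loos_triple k A c).

Lemma commutator_antisym x y : c x y = - c y x.
Proof. by rewrite /commutator opprB. Qed.

Lemma commutator_morph (h : {linear A -> A}) :
  algebra_morphism mu h -> algebra_morphism c h.
Proof. by move=> hM x y; rewrite /commutator linearB /= !hM. Qed.

Lemma teichmuller w x y z :
  as_ (mu w x) y z - as_ w (mu x y) z + as_ w x (mu y z)
  = mu w (as_ x y z) + mu (as_ w x y) z.
Proof. rewrite /associator !bilE; zmod. Qed.

Hypothesis altmu : alternative mu.

Lemma associator_swap12 x y z : as_ y x z = - as_ x y z.
Proof. by case: altmu. Qed.

Lemma associator_swap23 x y z : as_ x z y = - as_ x y z.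
Proof. by case: altmu. Qed.

Lemma associator_rot x y z : as_ y z x = as_ x y z.
Proof. by rewrite associator_swap23 associator_swap12 opprK. Qed.

(** The Jacobian expands to the signed sum of the associators over all six permutations, and
    alternativity makes the six signed terms equal. *)
Lemma commutator_jacobian x y z :
  c (c x y) z + c (c z x) y + c (c y z) x = as_ x y z *+ 6.
Proof.
have -> : as_ x y z *+ 6 = as_ x y z - as_ y x z + as_ y z x - as_ z y x
                           + as_ z x y - as_ x z y.
  rewrite (associator_rot x y z) -(associator_rot z x y).
  rewrite (associator_swap12 x y z) (associator_swap23 x y z).
  rewrite (associator_swap12 y z x) (associator_rot x y z); zmod.
rewrite /commutator /associator !bilE; zmod.
Qed.

Lemma loos_triple_associator x y z : T x y z = c (c x y) z *+ 3 - as_ x y z *+ 6.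
Proof. rewrite -commutator_jacobian /loos_triple; zmod. Qed.

Lemma commutator_leibniz u p z :
  c u (c p z) = c (c u p) z + c p (c u z) - as_ u p z *+ 6.
Proof. rewrite -commutator_jacobian /commutator !bilE; zmod. Qed.

(** * The Bruck-Kleinfeld function *)

Definition bruck_kleinfeld (w x y z : A) : A :=
  as_ (mu w x) y z - mu x (as_ w y z) - mu (as_ x y z) w.
Local Notation f := bruck_kleinfeld.

Lemma bruck_kleinfeld_swap34 w x y z : f w x z y = - f w x y z.
Proof.
rewrite /f (associator_swap23 (mu w x) y z) (associator_swap23 w y z).
rewrite (associator_swap23 x y z) !bilE; zmod.
Qed.

Lemma bruck_kleinfeld_teichmuller w x y z :
  f w x y z - f x y z w + f y z w x
  = c w (as_ x y z) - c x (as_ y z w) + c y (as_ z w x) - c z (as_ w x y).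
Proof.
have -> : f w x y z - f x y z w + f y z w x
  = as_ (mu w x) y z - as_ w (mu x y) z + as_ w x (mu y z)
    - mu x (as_ y z w) - mu (as_ x y z) w + mu y (as_ z w x)
    + mu (as_ y z w) x - mu z (as_ w x y) - mu (as_ z w x) y.
  rewrite /f -(associator_rot w (mu x y) z) -(associator_rot w x (mu y z)).
  rewrite (associator_rot x (mu y z) w).
  rewrite -(associator_rot w y z).
  rewrite (associator_rot x z w) (associator_rot y w x); zmod.
rewrite teichmuller /commutator; zmod.
Qed.

(** The right-hand side of [bruck_kleinfeld_teichmuller] changes sign under a cyclic shift; adding
    two consecutive shifts leaves only these two values of [f]. *)
Lemma bruck_kleinfeld_rot w x y z : f x y z w = - f w x y z.
Proof.
apply/eqP; rewrite -subr_eq0 opprK; apply/eqP.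
have -> : f x y z w + f w x y z
  = (f x y z w - f y z w x + f z w x y) + (f y z w x - f z w x y + f w x y z)
  by zmod.
rewrite !bruck_kleinfeld_teichmuller; zmod.
Qed.

(** Two rotations carry the first two arguments to the last two places, where
    [bruck_kleinfeld_swap34] applies; two more carry them back. *)
Lemma bruck_kleinfeld_swap12 w x y z : f x w y z = - f w x y z.
Proof.
rewrite (bruck_kleinfeld_rot z x w y) (bruck_kleinfeld_rot y z x w).
rewrite (bruck_kleinfeld_swap34 y z w x) (bruck_kleinfeld_rot x y z w).
rewrite (bruck_kleinfeld_rot w x y z); zmod.
Qed.

Lemma bruck_kleinfeld_rot3 w x y z : f w y z x = f w x y z.
Proof.
rewrite (bruck_kleinfeld_swap34 w y x z) (bruck_kleinfeld_rot z w y x).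
rewrite (bruck_kleinfeld_swap34 z w x y) (bruck_kleinfeld_rot z w x y); zmod.
Qed.

Lemma bruck_kleinfeld_commutator w x y z :
  f w x y z *+ 3
  = c w (as_ x y z) - c x (as_ y z w) + c y (as_ z w x) - c z (as_ w x y).
Proof.
rewrite -bruck_kleinfeld_teichmuller (bruck_kleinfeld_rot x y z w).
rewrite (bruck_kleinfeld_rot w x y z); zmod.
Qed.

Lemma associator_commutator w x y z :
  as_ (c w x) y z = f w x y z *+ 2 - c w (as_ x y z) + c x (as_ w y z).
Proof.
have -> : f w x y z *+ 2 = f w x y z - f x w y z.
  rewrite (bruck_kleinfeld_swap12 w x y z); zmod.
have -> : as_ (c w x) y z = as_ (mu w x) y z - as_ (mu x w) y z.
  rewrite /commutator /associator !bilE; zmod.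
rewrite /f /commutator; zmod.
Qed.

Lemma triple_derivation_commutator u : triple_derivation A T (c u).
Proof.
move=> x y z; rewrite !loos_triple_associator.
rewrite linearBr !linearMnr /=.
rewrite (commutator_leibniz u (c x y) z) (commutator_leibniz u x y).
have -> p q r : c (p + q - r *+ 6) z = c p z + c q z - c r z *+ 6.
  by rewrite linearBl linearDl linearMnl.
rewrite -(associator_rot u (c x y) z) -(associator_rot x (c u y) z).
rewrite (associator_rot (c u z) x y) !associator_commutator.
rewrite (bruck_kleinfeld_rot u x y z) (bruck_kleinfeld_rot3 u x y z).
rewrite -(bruck_kleinfeld_rot3 u z x y).
have -> : as_ y z u = as_ u y z by rewrite associator_rot.
have -> : as_ x z u = as_ u x z by rewrite associator_rot.
have -> : as_ y z x = as_ x y z by rewrite associator_rot.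
have -> : as_ z x y = as_ x y z by rewrite -associator_rot.
have -> : as_ u z x = - as_ u x z by rewrite associator_swap23.
(* Eliminating this bracket leaves the associator terms as multiples of [f u x y z] and of brackets
   with [x], [y], [z], which then cancel. *)
have -> : c u (as_ x y z) = f u x y z *+ 3 + c x (as_ u y z)
                            - c y (as_ u x z) + c z (as_ u x y).
  rewrite bruck_kleinfeld_commutator.
  have -> : as_ y z u = as_ u y z by rewrite associator_rot.
  have -> : as_ z u x = as_ u x z by rewrite -associator_rot.
  zmod.
have -> p : c y (- p) = - c y p by rewrite linearNr.
rewrite (commutator_antisym (as_ u x y) z); zmod.
Qed.

(** * Inner derivations and the untwisted Jacobi identity *)

Definition inner_derivation (x y z : A) : A := c (c x y) z - as_ x y z *+ 3.
Local Notation D := inner_derivation.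

Lemma inner_derivation_is_zmod_morphism x y : zmod_morphism (D x y).
Proof.
move=> u v; rewrite /D /commutator /associator !bilE; zmod.
Qed.

HB.instance Definition _ x y :=
  GRing.isZmodMorphism.Build A A (D x y) (inner_derivation_is_zmod_morphism x y).

(** The Leibniz defect of [c (c x y)] is [- as_ (c x y) a b *+ 3] by [adP], and that of [as_ x y] is
    [- as_ (c x y) a b] by [asP]; hence the factor [3] in [D]. *)
Lemma inner_derivationP x y : derivation A mu (D x y).
Proof.
move=> a b.
have adP p : c p (mu a b) = mu (c p a) b + mu a (c p b) - as_ p a b *+ 3.
  have -> : as_ p a b *+ 3 = as_ p a b - as_ a p b + as_ a b p.
    rewrite (associator_swap12 p a b) (associator_rot p a b); zmod.
  rewrite /commutator /associator !bilE; zmod.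
have asP : as_ (c x y) a b = mu (as_ x y a) b + mu a (as_ x y b)
                             - as_ x y (mu a b).
  have f_eq : f a b x y = f x y a b.
    rewrite (bruck_kleinfeld_rot y a b x) (bruck_kleinfeld_rot x y a b); zmod.
  have -> : as_ x y (mu a b) = f x y a b + mu b (as_ x y a) + mu (as_ x y b) a.
    rewrite -f_eq /f (associator_rot b x y) (associator_rot a x y).
    rewrite -(associator_rot (mu a b) x y); zmod.
  have f3 := bruck_kleinfeld_commutator x y a b.
  rewrite (associator_rot x a b) -(associator_rot b x y) in f3.
  rewrite associator_commutator.
  (* [f3] rewrites only the triple of [f]; the remaining [- f x y a b] matches the one from the
     expansion of [as_ x y (mu a b)]. *)
  have -> : f x y a b *+ 2 = f x y a b *+ 3 - f x y a b by zmod.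
  rewrite f3 /commutator; zmod.
rewrite /D adP asP !bilE; zmod.
Qed.

Lemma derivation_commutator (d : {additive A -> A}) :
  derivation A mu d -> derivation A c d.
Proof.
move=> dP x y; rewrite /commutator raddfB !dP /=; zmod.
Qed.

Lemma loos_triple_jacobi x y : triple_derivation A T (T x y).
Proof.
have adD := triple_derivationD k A c.
have DP : triple_derivation A T (D x y).
  apply/derivation_loos_triple/derivation_commutator/inner_derivationP.
have E z : T x y z = (c (c x y) z + D x y z) + D x y z.
  rewrite loos_triple_associator /D; zmod.
have := adD _ _ (adD _ _ (triple_derivation_commutator (c x y)) DP) DP.
by move=> H u v w; rewrite !(E u, E v, E w, E (T u v w)); apply: H.
Qed.

End Alternative.

Theorem corollary3p18 (k : fieldType) (char0 : [pchar k] =i pred0)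
    (A : lmodType k) (mu : {bilinear A -> A -> A}) (alpha : {linear A -> A}) :
  alternative mu -> algebra_morphism mu alpha ->
  multiplicative_hlts (twisted_bracket mu alpha) alpha alpha.
Proof.
move=> altmu morph_alpha.
have bE x y z : twisted_bracket mu alpha x y z
                = alpha (loos_triple k A (commutator mu) x y z) by [].
have morphT := loos_triple_morph k A (commutator mu) alpha
  (commutator_morph k A mu alpha morph_alpha).
split=> //; first split.
- have [tri1 tri2 tri3] := loos_triple_trilinear k A (commutator mu).
  split=> x y a u v; rewrite !bE.
  + by rewrite tri1 linearP.
  + by rewrite tri2 linearP.
  + by rewrite tri3 linearP.
- exact: linearP.
- exact: linearP.
- move=> u v w; rewrite !bE -linearN /= -loos_triple_antisym //.
  exact: commutator_antisym.
- by move=> u v w; rewrite !bE -!linearD /= loos_triple_cyclic linear0.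
(* Each term becomes [alpha] applied twice to its untwisted counterpart. *)
- move=> u v w x y; rewrite !bE -!morphT -!linearD /=.
  by rewrite loos_triple_jacobi.
- by move=> x y z; rewrite !bE -morphT.
Qed.
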